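(* Let $G$ be a graph on vertex set $[2n]$ with edge set $E\subseteq\binom{[2n]}{2}$, and let $H$ be the 3-graph on $[2n+1]$ with triple set $\{\{i,j,2n+1\}: ij\in E\}$. Then $H$ has a 3-Pfaffian orientation if and only if $G$ has a Pfaffian orientation. More precisely, an orientation of $G$ is Pfaffian if and only if the triple orientation of $H$ that assigns to $\{i,j,2n+1\}$ the cyclic order $(i\,j\,2n+1)$ whenever the edge $ij$ is oriented $i\to j$ is 3-Pfaffian.
   Context: A cycle in a 3-graph is a sequence $a_0,t_1,a_1,\dots,t_\ell,a_\ell=a_0$, $\ell\ge2$, of distinct vertices $a_0,\dots,a_{\ell-1}$ and distinct triples with $a_{i-1},a_i\in t_i$; a spanning tree is a set of triples containing no cycle, covering all vertices, connected via paths of triples. A triple orientation $\omega$ of a 3-graph on $[2n+1]$ assigns each triple $t=\{i,j,k\}$ a 3-cycle $\sigma(t,\omega)\in\{(i\,j\,k),(j\,i\,k)\}$; for a spanning tree $T$, $\prod_{t\in T}\sigma(t,\omega)$ is a $(2n+1)$-cycle $(s(1)\cdots s(2n+1))$, and $\mathrm{sgn}(T,\omega)$ is the sign of the permutation $s$ (well defined). $\omega$ is 3-Pfaffian if $\mathrm{sgn}(T,\omega)$ is constant over all spanning trees. For a graph on $[2n]$, a perfect matching $M$ has sign $\mathrm{sgn}(M)=(-1)^{\#\{i<j<k<l:\{i,k\},\{j,l\}\in M\}}$; an orientation of the edges is Pfaffian if $\mathrm{sgn}(M)\cdot(-1)^{\#\{ij\in M: i<j,\ \text{oriented } j\to i\}}$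 is the same for all perfect matchings $M$. *)

(* Defs.v *)
From HB Require Import structures.
From mathcomp Require Import all_boot all_order all_algebra all_fingroup.

Set Implicit Arguments.
Unset Strict Implicit.
Unset Printing Implicit Defensive.

Import GRing.Theory.

(** Hypergraphs are given by their set of edges. *)
Definition uniform (r : nat) (V : finType) (H : {set {set V}}) : Prop :=
  forall e, e \in H -> #|e| = r.

(** ** Spanning trees of 3-graphs *)

(** The cycle a_0, t_1, a_1, ..., t_l, a_l = a_0: here [t i] stands for
    t_(i+1), and [ordS] is the successor modulo l. *)
Definition has_cycle (V : finType) (T : {set {set V}}) : Prop :=
  exists (l : nat) (a : 'I_l -> V) (t : 'I_l -> {set V}),
    [/\ 2 <= l, injective a, injective t &
        forall i, [/\ t i \in T, a i \in t i & a (ordS i) \in t i]].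

(** The path x = a_0, t_1, a_1, ..., t_l, a_l = y, l >= 0; again [t i] stands
    for t_(i+1), and [lift ord0 i] has value i + 1. *)
Definition joined (V : finType) (T : {set {set V}}) (x y : V) : Prop :=
  exists (l : nat) (a : 'I_l.+1 -> V) (t : 'I_l -> {set V}),
    [/\ injective a, injective t, a ord0 = x, a ord_max = y &
        forall i : 'I_l, [/\ t i \in T, a (widen_ord (leqnSn l) i) \in t i
                           & a (lift ord0 i) \in t i]].

Definition spanning_tree (V : finType) (H T : {set {set V}}) : Prop :=
  [/\ T \subset H, ~ has_cycle T, cover T = [set: V]
    & forall x y, joined T x y].

(** ** 3-Pfaffian orientations *)

(** The 3-cycle (i j k), for distinct i, j, k. *)
Definition cyc3 (V : finType) (i j k : V) : {perm V} :=
  (tperm i j * tperm i k)%g.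

Lemma cyc3E (V : finType) (i j k : V) : uniq [:: i; j; k] ->
  [/\ cyc3 i j k i = j, cyc3 i j k j = k, cyc3 i j k k = i
    & forall x, x \notin [:: i; j; k] -> cyc3 i j k x = x].
Proof.
rewrite /= !inE negb_or andbT => /andP[/andP[ij ik] jk].
rewrite /cyc3; split=> [|||x]; rewrite permM.
- by rewrite tpermL tpermD // eq_sym.
- by rewrite tpermR tpermL.
- by rewrite (tpermD ik jk) tpermR.
by rewrite !inE !negb_or => /and3P[xi xj xk]; rewrite !tpermD // eq_sym.
Qed.

(** [w t] is sigma(t, w); its values on sets outside [H] are irrelevant. *)
Definition triple_orientation (V : finType) (H : {set {set V}})
    (w : {set V} -> {perm V}) : Prop :=
  forall i j k, uniq [:: i; j; k] -> [set i; j; k] \in H ->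
    w [set i; j; k] = cyc3 i j k \/ w [set i; j; k] = cyc3 j i k.

(** The product of the sigma(t, w), taken in the order [ts] of the triples of
    [T], is the cycle (s(1) ... s(m)). *)
Definition presents (m : nat) (T : {set {set 'I_m}})
    (w : {set 'I_m} -> {perm 'I_m}) (ts : seq {set 'I_m}) (s : {perm 'I_m}) :
    Prop :=
  perm_eq ts (enum T) /\
  forall i, (\prod_(t <- ts) w t)%g (s i) = s (ordS i).

(** sgn(T, w) = eps. The order of the factors and the choice of [s] are
    arbitrary, so [eps] is required to be the common value of all choices. *)
Definition tree_sgn (m : nat) (T : {set {set 'I_m}})
    (w : {set 'I_m} -> {perm 'I_m}) (eps : int) : Prop :=
  (exists ts s, presents T w ts s) /\
  (forall ts s, presents T w ts s -> ((-1) ^+ odd_perm s)%R = eps).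

Definition pfaffian3 (n : nat) (H : {set {set 'I_(2 * n).+1}})
    (w : {set 'I_(2 * n).+1} -> {perm 'I_(2 * n).+1}) : Prop :=
  triple_orientation H w /\
  exists eps : int, forall T, spanning_tree H T -> tree_sgn T w eps.

(** ** Pfaffian orientations of graphs *)

(** [D i j] means that ij is an edge, oriented i -> j. *)
Definition orientation (V : finType) (E : {set {set V}}) (D : rel V) : Prop :=
  (forall i j, D i j -> [set i; j] \in E) /\
  (forall i j, i != j -> [set i; j] \in E -> D i j (+) D j i).

Definition perfect_matching (V : finType) (E M : {set {set V}}) : bool :=
  (M \subset E) && partition M [set: V].

Definition matching_sgn (m : nat) (M : {set {set 'I_m}}) : int :=
  ((-1) ^+ #|[set q : 'I_m * 'I_m * 'I_m * 'I_m |
      let: (i, j, k, l) := q in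
      [&& (i < j)%N, (j < k)%N, (k < l)%N,
          [set i; k] \in M & [set j; l] \in M]]|)%R.

Definition backward_sgn (m : nat) (D : rel 'I_m) (M : {set {set 'I_m}}) : int :=
  ((-1) ^+ #|[set p : 'I_m * 'I_m |
      let: (i, j) := p in [&& (i < j)%N, [set i; j] \in M & D j i]]|)%R.

Definition pfaffian (n : nat) (E : {set {set 'I_(2 * n)}})
    (D : rel 'I_(2 * n)) : Prop :=
  orientation E D /\
  exists eps : int, forall M, perfect_matching E M ->
    (matching_sgn M * backward_sgn D M)%R = eps.

(** ** The 3-graph obtained by adding one vertex to every edge *)

Definition old (m : nat) (i : 'I_m) : 'I_m.+1 := widen_ord (leqnSn m) i.

Definition cone_triple (m : nat) (i j : 'I_m) : {set 'I_m.+1} :=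
  [set old i; old j; ord_max].

Definition cone (m : nat) (E : {set {set 'I_m}}) : {set {set 'I_m.+1}} :=
  [set cone_triple p.1 p.2 | p : 'I_m * 'I_m & [set p.1; p.2] \in E].

(** Characterized by [cone_orientationE] below; the value 1 is only taken
    outside the 3-graph. *)
Definition cone_orientation (m : nat) (D : rel 'I_m) (t : {set 'I_m.+1}) :
    {perm 'I_m.+1} :=
  if [pick p : 'I_m * 'I_m | D p.1 p.2 && (t == cone_triple p.1 p.2)]
    is Some p
  then cyc3 (old p.1) (old p.2) ord_max else 1%g.

Lemma mem_cone_triple (m : nat) (i j k : 'I_m) :
  (old k \in cone_triple i j) = (k \in [set i; j]).
Proof.
by rewrite !inE -!val_eqE /= (ltn_eqF (ltn_ord k)) orbF.
Qed.

Lemma cone_orientationE (m : nat) (E : {set {set 'I_m}}) (D : rel 'I_m)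
    (i j : 'I_m) :
  uniform 2 E -> orientation E D -> D i j ->
  cone_orientation D (cone_triple i j) = cyc3 (old i) (old j) ord_max.
Proof.
move=> E2 [DE Dx] Dij; rewrite /cone_orientation.
have neq a b : D a b -> a != b.
  by move=> /DE/E2; rewrite cards2; case: eqP.
case: pickP => [[a b] /= /andP[Dab /eqP eqt] | /(_ (i, j))]; last first.
  by rewrite /= Dij eqxx.
have := mem_cone_triple a b i; have := mem_cone_triple a b j.
rewrite -eqt !mem_cone_triple !inE !eqxx orbT => /esym jab /esym iab.
have nij := neq _ _ Dij.
case/orP: iab jab => /eqP iE; case/orP=> /eqP jE; subst=> //.
- by rewrite eqxx in nij.
- by have := Dx _ _ nij (DE _ _ Dij); rewrite Dij Dab.
by rewrite eqxx in nij.
Qed.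

(* Main.v *)
(* In a spanning tree of the cone, two triples meet only in the apex (otherwise
   they form a cycle of length 2), so the spanning trees are the cones over the
   perfect matchings.  If the edges of a matching M are oriented i_1 -> j_1,
   ..., i_n -> j_n, then the product of the 3-cycles (i_k j_k apex) is the cycle
   (i_1 j_1 ... i_n j_n apex).  The sign of this word is the parity of its
   inversions: the inversions inside a block i_k j_k are the backward edges, and
   two blocks contribute an odd number of inversions exactly when the two edges
   cross.  Hence the sign of the tree is the signed matching sign of M. *)

Require Import Defs.
From mathcomp Require Import all_boot all_order all_algebra all_fingroup.
From mathcomp Require Import zify.

Set Implicit Arguments.
Unset Strict Implicit.
Unset Printing Implicit Defensive.

Import Order.TTheory GRing.Theory Num.Theory.

(** * Inversions of a word and the sign of a permutation *)

Fixpoint inversions (u : seq nat) : nat :=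
  if u is x :: v then (count (fun y => y < x) v + inversions v)%N else 0.

(** The double sum over positions i < j has the shape of the Vandermonde product. *)
Lemma inversionsE (u : seq nat) : inversions u =
  \sum_(i < size u) \sum_(j < size u | i < j) (nth 0 u j < nth 0 u i).
Proof.
elim: u => [|x u IH]; first by rewrite big_ord0.
rewrite /= big_ord_recl IH; congr (_ + _)%N.
  rewrite big_mkcond big_ord_recl /= add0n -sum1_count big_mkcond /=.
  rewrite (big_nth 0) big_mkord; apply: eq_bigr => i _ /=.
  by rewrite /bump /=; case: (nth _ _ _ < x).
apply: eq_bigr => i _; rewrite [RHS]big_mkcond big_ord_recl /= add0n.
by rewrite [LHS]big_mkcond.
Qed.

(** Needed for the apex, which is the largest vertex and closes the word. *)
Lemma inversions_rcons (u : seq nat) (x : nat) :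
  all (fun y => y < x) u -> inversions (rcons u x) = inversions u.
Proof.
elim: u => //= y u IH /andP[yx /IH ->]; rewrite -cats1 count_cat /=.
by rewrite ltnNge (ltnW yx) !addn0.
Qed.

(* Permuting the columns of the Vandermonde determinant of 0, ..., m-1
   multiplies it by the sign of s, and each inversion of s flips the sign of one
   factor of the product formula. *)
Lemma odd_perm_inversions (m : nat) (s : {perm 'I_m}) :
  odd_perm s = odd (inversions [seq val (s i) | i <- enum 'I_m]).
Proof.
pose V (f : 'I_m -> 'I_m) : 'rV[int]_m := (\row_j (f j)%:R)%R.
have pos : (0 < \det (Vandermonde m (V id)))%R.
  rewrite det_Vandermonde; apply: prodr_gt0 => i _; apply: prodr_gt0 => j ij.
  by rewrite !mxE subr_gt0 ltr_nat.
have detE :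
    (\det (Vandermonde m (V s)) = \det (Vandermonde m (V id)) * (-1) ^+ s)%R.
  (* The inverse appears because [col_perm] is right multiplication by the matrix of the inverse
     permutation. *)
  rewrite -odd_permV -det_perm -det_mulmx -col_permE; congr (\det _)%R.
  by apply/matrixP=> i j; rewrite !mxE.
(* Taking signs cancels the positive determinant and leaves only the sign of [s]. *)
have /(congr1 Num.sg) := detE.
rewrite sgrM sgrX sgrN1 (gtr0_sg pos) mul1r det_Vandermonde.
rewrite (big_morph _ (@sgrM _) (@sgr1 _)).
under eq_bigr => i _.
  rewrite (big_morph _ (@sgrM _) (@sgr1 _)).
  under eq_bigr => j ij.
    have -> : Num.sg (V s 0 j - V s 0 i)%R = ((-1) ^+ (s j < s i)%N :> int)%R.
      rewrite !mxE; case: (ltngtP (s j) (s i)) => h.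
      - by rewrite ltr0_sg // subr_lt0 ltr_nat.
      - by rewrite gtr0_sg // subr_gt0 ltr_nat.
      by move: ij; rewrite (perm_inj (val_inj h)) ltnn.
    over.
  rewrite prodrXr. over.
rewrite prodrXr => H.
have nthE (j : 'I_m) : nth 0 [seq val (s i) | i <- enum 'I_m] j = s j.
  by rewrite (nth_map j) ?size_enum_ord ?nth_ord_enum.
have -> : inversions [seq val (s i) | i <- enum 'I_m] =
          \sum_(i < m) \sum_(j < m | i < j) (s j < s i)%N.
  rewrite inversionsE size_map size_enum_ord; apply: eq_bigr => i _.
  by apply: eq_bigr => j _; rewrite !nthE.
by apply/eqP; rewrite -(inj_eq (@signr_inj int)) signr_odd H.
Qed.

(** * Crossings and inversions in a word of pairs *)

(** Asymmetric: the first chord has the smaller left end, so a crossing pair counts in exactly one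
    of its two orders. *)
Definition crosses (a b c d : nat) : bool :=
  [&& minn a b < minn c d, minn c d < maxn a b & maxn a b < maxn c d].

(** Separated blocks give 0 or 4 inversions, nested ones 2, crossing ones 1 or 3. *)
Lemma odd_crosses (a b c d : nat) : uniq [:: a; b; c; d] ->
  odd ((c < a) + (d < a) + ((c < b) + (d < b))) =
  odd (crosses a b c d + crosses c d a b).
Proof.
rewrite /= !inE !negb_or /crosses /minn /maxn.
case: (ltngtP a b) => //; case: (ltngtP c d) => //; case: (ltngtP a c) => //;
case: (ltngtP a d) => //; case: (ltngtP b c) => //; case: (ltngtP b d) => //=;
lia.
Qed.

Definition word (T : Type) (ps : seq (T * T)) : seq T :=
  flatten [seq [:: p.1; p.2] | p <- ps].

Lemma size_word (T : Type) (ps : seq (T * T)) : size (word ps) = (2 * size ps)%N.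
Proof. by elim: ps => //= p ps IH; rewrite /word /= -/(word ps) IH mulnS. Qed.

(** Inversions inside a block are the decreasing pairs; those between two blocks have the parity
    given by [odd_crosses]. The sum over ordered pairs of blocks counts each crossing once, and its
    diagonal vanishes. *)
Lemma odd_inversions_word (m : nat) (ps : seq ('I_m * 'I_m)) : uniq (word ps) ->
  odd (inversions [seq val i | i <- word ps]) =
  odd (count (fun p : 'I_m * 'I_m => p.2 < p.1) ps +
       \sum_(p <- ps) \sum_(q <- ps) crosses p.1 p.2 q.1 q.2).
Proof.
elim: ps => [|[a b] ps IH]; first by rewrite big_nil.
rewrite /word /= -/(word ps) inE negb_or.
case/and3P=> /andP[ab aw] bw uw.
(* Inversions between the first block and all later ones, grouped by later block. *)
have abE : odd (count (fun y => y < a) [seq val i | i <- word ps] +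
                count (fun y => y < b) [seq val i | i <- word ps]) =
           odd (\sum_(q <- ps) crosses a b q.1 q.2 +
                \sum_(q <- ps) crosses q.1 q.2 a b).
  rewrite -big_split /=; elim: ps {IH} aw bw uw => [|[c d] ps IH].
    by rewrite big_nil.
  rewrite big_cons /word /= -/(word ps) !inE !negb_or.
  case/and3P=> ac ad aw /and3P[bc bd bw] /and3P[/andP[cd _] _ uw].
  have /odd_crosses : uniq [:: val a; val b; val c; val d].
    by rewrite /= !inE !negb_or ab ac ad bc bd cd.
  move=> /= cE; rewrite (addnA (c < a)) (addnA (c < b)) addnACA.
  by rewrite oddD cE (IH aw bw uw) -oddD.
rewrite !big_cons.
have -> : \sum_(p <- ps) \sum_(q <- (a, b) :: ps) crosses p.1 p.2 q.1 q.2 =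
    (\sum_(p <- ps) crosses p.1 p.2 a b +
     \sum_(p <- ps) \sum_(q <- ps) crosses p.1 p.2 q.1 q.2)%N.
  by rewrite -big_split /=; apply: eq_bigr => p _; rewrite big_cons.
rewrite /= [crosses a b a b](_ : _ = false); last by rewrite /crosses ltnn.
rewrite addnA -(addnA (b < a)) oddD (IH uw) [in LHS]oddD abE !oddD.
by do 6!case: (odd _).
Qed.

Lemma mem_word (T : eqType) (ps : seq (T * T)) (x : T) :
  (x \in word ps) = has (fun p => (x == p.1) || (x == p.2)) ps.
Proof. by elim: ps => //= p ps IH; rewrite /word /= !inE -/(word ps) IH orbA. Qed.

Lemma uniq_word_inj (T : eqType) (ps : seq (T * T)) (p q : T * T) (x : T) :
  uniq (word ps) -> p \in ps -> q \in ps ->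
  x \in [:: p.1; p.2] -> x \in [:: q.1; q.2] -> p = q.
Proof.
elim: ps => // -[a b] ps IH; rewrite /word /= -/(word ps) !inE negb_or.
case/and3P=> /andP[_ aw] bw uw.
have notin c r : c \notin word ps -> r \in ps ->
    (c == r.1) || (c == r.2) = false.
  by rewrite mem_word => /hasPn cw /cw /negbTE.
case/predU1P=> [-> | p_ps]; case/predU1P=> [-> | q_ps] //=.
- by case/orP=> /eqP->; rewrite notin.
- by move=> xp; case/orP=> /eqP xE; move: xp; rewrite xE notin.
by move=> xp xq; apply: IH => //; rewrite !inE.
Qed.

Lemma uniq_word_neq (T : eqType) (ps : seq (T * T)) (p : T * T) :
  uniq (word ps) -> p \in ps -> p.1 != p.2.
Proof.
elim: ps => // -[a b] ps IH; rewrite /word /= -/(word ps) !inE negb_or.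
by case/and3P=> /andP[ab _] _ uw /predU1P[-> | /IH]; last exact.
Qed.

Lemma uniq_word_uniq (T : eqType) (ps : seq (T * T)) : uniq (word ps) -> uniq ps.
Proof.
elim: ps => // -[a b] ps IH; rewrite /word /= -/(word ps) !inE negb_or.
case/and3P=> /andP[_ aw] _ /IH ->; rewrite andbT.
by apply: contra aw => ps_ab; rewrite mem_word; apply/hasP; exists (a, b);
  rewrite //= eqxx.
Qed.

Lemma card_mem_seq (T : finType) (A : {set T}) (s : seq T) :
  uniq s -> A =i s -> #|A| = size s.
Proof. by move=> /card_uniqP <- /eq_card. Qed.

(** * The two matching signs read off a word *)

Section WordSigns.

Variables (m : nat) (M : {set {set 'I_m}}) (ps : seq ('I_m * 'I_m)).
Hypotheses (uw : uniq (word ps)) (Mps : M =i [seq [set p.1; p.2] | p <- ps]).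

(** Blocks follow the orientation, whereas both signs index an edge by its sorted ends. *)
Let lo (p : 'I_m * 'I_m) := if p.1 < p.2 then p.1 else p.2.
Let hi (p : 'I_m * 'I_m) := if p.1 < p.2 then p.2 else p.1.

Lemma mem_matchingP (i k : 'I_m) : i < k ->
  reflect (exists2 p, p \in ps & (lo p, hi p) = (i, k)) ([set i; k] \in M).
Proof.
move=> ik; rewrite Mps; apply: (iffP mapP) => [[[a b] pps /= abE] | [[a b] pps]].
  exists (a, b) => //; rewrite /lo /hi /=.
  have ia : i \in [set a; b] by rewrite -abE set21.
  have ka : k \in [set a; b] by rewrite -abE set22.
  move: ik ia ka; rewrite !inE => ik /orP[]/eqP ? /orP[]/eqP ?; subst.
  - by rewrite ltnn in ik.
  - by rewrite ik.
  - by rewrite ltnNge (ltnW ik).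
  by rewrite ltnn in ik.
move=> [<- <-]; exists (a, b) => //=; rewrite /lo /hi /=.
by case: ifP => // _; rewrite setUC.
Qed.

Lemma lo_hi_inj : {in ps &, forall p q, lo p = lo q -> p = q}.
Proof.
move=> p q pps qps e; apply: (uniq_word_inj uw pps qps (x := lo p)).
  by rewrite /lo !inE; case: ifP; rewrite eqxx ?orbT.
by rewrite e /lo !inE; case: ifP; rewrite eqxx ?orbT.
Qed.

Lemma matching_sgn_word :
  matching_sgn M =
  ((-1) ^+ (\sum_(p <- ps) \sum_(q <- ps) crosses p.1 p.2 q.1 q.2))%R.
Proof.
(* The quadruple (i, j, k, l) of a crossing, with [r.1] the edge ik and [r.2] the edge jl; it is
   injective because the smaller end determines the block. *)
pose f (r : ('I_m * 'I_m) * ('I_m * 'I_m)) := (lo r.1, lo r.2, hi r.1, hi r.2).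
pose X (r : ('I_m * 'I_m) * ('I_m * 'I_m)) :=
  crosses r.1.1 r.1.2 r.2.1 r.2.2.
have XE r : X r = [&& lo r.1 < lo r.2, lo r.2 < hi r.1 & hi r.1 < hi r.2].
  rewrite /X /crosses /lo /hi /minn /maxn.
  by case: (r.1.1 < r.1.2); case: (r.2.1 < r.2.2).
pose s := [seq f r | r <- [seq (p, q) | p <- ps, q <- ps] & X r].
rewrite /matching_sgn (card_mem_seq (s := s)).
- rewrite size_map size_filter -sum1_count big_mkcond big_allpairs /=.
  by congr (_ ^+ _)%R; do 2!(apply: eq_bigr => ? _); rewrite /X; case: crosses.
- rewrite map_inj_in_uniq => [|[p q] [p' q']].
    by rewrite filter_uniq // allpairs_uniq ?uniq_word_uniq // => -[? ?] [].
  rewrite !mem_filter => /andP[_ /allpairsP[[? ?] /= [? ? [-> ->]]]].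
  move=> /andP[_ /allpairsP[[? ?] /= [? ? [-> ->]]]] [] /lo_hi_inj-> //.
  by move=> /lo_hi_inj->.
move=> [[[i j] k] l]; rewrite inE; apply/idP/mapP => [|[[p q]]].
  case/and5P=> ij jk kl.
  case/(mem_matchingP (ltn_trans ij jk))=> p pps [iE kE].
  case/(mem_matchingP (ltn_trans jk kl))=> q qps [jE lE].
  subst i j k l.
  exists (p, q) => //; rewrite mem_filter XE /= ij jk kl.
  by apply/allpairsP; exists (p, q).
rewrite mem_filter XE /= => /andP[/and3P[ij jk kl]].
case/allpairsP=> [[p' q'] /= [pps qps [pE qE]]] [-> -> -> ->].
rewrite ij jk kl /=; apply/andP; split.
  apply/mem_matchingP; first exact: ltn_trans jk.
  by exists p; rewrite // pE.
apply/mem_matchingP; first exact: ltn_trans kl.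
by exists q; rewrite // qE.
Qed.

(** Every block follows [D], so backward edges are the decreasing blocks; asymmetry keeps increasing
    blocks from being counted. *)
Lemma backward_sgn_word (D : rel 'I_m) :
  (forall p, p \in ps -> D p.1 p.2) -> (forall i j, D i j -> ~~ D j i) ->
  backward_sgn D M = ((-1) ^+ count (fun p : 'I_m * 'I_m => p.2 < p.1)%N ps)%R.
Proof.
move=> Dps Das.
pose s := [seq (lo p, hi p) | p : 'I_m * 'I_m <- ps & p.2 < p.1].
rewrite /backward_sgn (card_mem_seq (s := s)).
- by rewrite size_map size_filter.
- rewrite map_inj_in_uniq ?filter_uniq ?uniq_word_uniq // => p q.
  by rewrite !mem_filter => /andP[_ pps] /andP[_ qps] [/lo_hi_inj->].
move=> [i j]; rewrite inE; apply/idP/mapP => [|[p]].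
  case/and3P=> ij /(mem_matchingP ij)[p pps pE] Dji.
  exists p => //; rewrite mem_filter pps andbT ltnNge.
  apply/negP => p12; have := Dps p pps; have pn := uniq_word_neq uw pps.
  have lt12 : p.1 < p.2 by rewrite ltn_neqAle p12 andbT.
  by move: pE; rewrite /lo /hi lt12 => -[-> ->] /Das; rewrite Dji.
rewrite mem_filter => /andP[p21 pps] pE.
have p12 : p.1 < p.2 = false by rewrite ltnNge (ltnW p21).
have ij : i < j by case: pE => -> ->; rewrite /lo /hi p12.
rewrite ij /=; apply/andP; split; first by apply/mem_matchingP => //; exists p.
by case: pE => -> ->; rewrite /lo /hi p12 Dps.
Qed.

End WordSigns.

(** * Rotations of a listed cycle *)

Lemma iter_ordS (m k : nat) (i : 'I_m) : iter k (@ordS m) i = (i + k) %% m :> nat.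
Proof.
elim: k => [|k IH] /=; first by rewrite addn0 modn_small.
by rewrite IH -addn1 modnDml addn1 addnS.
Qed.

Lemma odd_permX (T : finType) (s : {perm T}) (k : nat) :
  odd_perm (s ^+ k)%g = odd k && odd_perm s.
Proof.
elim: k => [|k IH]; first by rewrite expg0 odd_perm1.
by rewrite expgS odd_permM IH /=; case: (odd k); case: odd_perm.
Qed.

(* Both s and s' list the same cycle, so they differ by a rotation, which is an
   even permutation because the cycle has odd length. *)
Lemma presents_odd_perm (m : nat) (T : {set {set 'I_m.+1}})
    (w : {set 'I_m.+1} -> {perm 'I_m.+1}) (ts : seq {set 'I_m.+1})
    (s s' : {perm 'I_m.+1}) : ~~ odd m ->
  presents T w ts s -> presents T w ts s' -> odd_perm s = odd_perm s'.
Proof.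
move=> m_even [_ sP] [_ s'P]; set P := (\prod_(t <- ts) w t)%g in sP s'P.
pose c : {perm 'I_m.+1} := perm (@ordS_inj m.+1).
have cX k i : (c ^+ k)%g i = iter k (@ordS _) i.
  by rewrite permX; apply: eq_iter => j; rewrite permE.
have c1 : (c ^+ m.+1)%g = 1%g.
  apply/permP=> i; rewrite cX perm1; apply: val_inj.
  by rewrite [LHS]iter_ordS modnDr modn_small.
(* The order of the rotation [c] divides the odd number m + 1, so [c] is even. *)
have c_even : odd_perm c = false.
  by have := congr1 (@odd_perm 'I_m.+1) c1; rewrite odd_permX odd_perm1 /= m_even.
have iterE (u : {perm 'I_m.+1}) : (forall i, P (u i) = u (ordS i)) ->
    forall k i, iter k P (u i) = u (iter k (@ordS _) i).
  by move=> uP; elim=> //= k IH i; rewrite IH uP.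
have ordE (i : 'I_m.+1) : i = iter i (@ordS _) ord0.
  by apply: val_inj; rewrite [RHS]iter_ordS add0n modn_small.
(* The position at which [s'] lists the first entry of [s]: the amount of rotation. *)
pose r : 'I_m.+1 := (s'^-1)%g (s ord0).
suff -> : s = (c ^+ r * s')%g by rewrite odd_permM odd_permX c_even andbF.
apply/permP=> i; rewrite permM cX [in LHS](ordE i) -iterE //.
have -> : s ord0 = s' r by rewrite permKV.
by rewrite iterE // [r in LHS]ordE -iterD addnC iterD -ordE.
Qed.

(** * Products of 3-cycles through a common point *)

(** Permutations compose from left to right, so the left factor (a b z) inserts a, b directly after
    z: z goes to a, a to b, and b through z to the former successor of z. *)
Lemma prod_cyc3_next (T : finType) (z : T) (ps : seq (T * T)) :
  uniq (z :: word ps) ->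
  (\prod_(p <- ps) cyc3 p.1 p.2 z)%g =1 next (z :: word ps).
Proof.
elim: ps => [|[a b] ps IH] uw x; first by rewrite big_nil perm1 /=; case: eqP.
rewrite big_cons permM /=.
have abz : uniq [:: a; b; z].
  move: uw; rewrite /word /= !inE !negb_or -!andbA => /and5P[za zb _ ab _].
  by rewrite ab eq_sym za eq_sym zb.
have uw' : uniq (z :: word ps).
  by move: uw; rewrite /word /= !inE !negb_or -!andbA => /and5P[_ _ -> _ /and3P[]].
have [ca cb cz cx] := cyc3E abz.
have notw y : y \notin z :: word ps -> next (z :: word ps) y = y.
  by rewrite next_nth => /negbTE->.
have az : a \notin z :: word ps.
  move: uw; rewrite /word /= !inE !negb_or (eq_sym a z) -!andbA.
  by case/and5P=> -> _ _ _ /andP[-> _].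
have bz : b \notin z :: word ps.
  move: uw; rewrite /word /= !inE !negb_or (eq_sym b z) -!andbA.
  by case/and5P=> _ -> _ _ /and3P[_ -> _].
rewrite IH //.
case: (eqVneq x z) => [-> | xz]; first by rewrite cz notw.
case: (eqVneq x a) => [-> | xa].
  by rewrite ca notw.
case: (eqVneq x b) => [-> | xb].
  rewrite cb /word /= -/(word ps).
  by case: (word ps) => [|y v] /=; rewrite ?eqxx.
rewrite cx ?inE ?negb_or ?xa ?xb //= /word /= -/(word ps).
by case: (word ps) => [|y v] /=; rewrite ?(negbTE xz) ?(negbTE xb).
Qed.

(** The default value [z] sits at position [size v], so the cycle is read as [v] followed by [z],
    with the apex last. *)
Lemma next_nth_cons (T : eqType) (z : T) (v : seq T) (i : nat) :
  uniq (z :: v) -> i <= size v ->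
  next (z :: v) (nth z v i) = nth z v (i.+1 %% (size v).+1).
Proof.
move=> uv; rewrite leq_eqVlt => /predU1P[-> | iv].
  by rewrite nth_default // modnn next_nth mem_head /= eqxx.
rewrite next_nth inE mem_nth // orbT modn_small //.
by rewrite -[nth z v i]/(nth z (z :: v) i.+1) index_uniq.
Qed.

(** * Words of old vertices closed by the apex *)

Lemma old_inj (m : nat) : injective (@old m).
Proof. by move=> i j /(congr1 val) /= ij; apply: val_inj. Qed.

Lemma old_neq_max (m : nat) (i : 'I_m) : old i != ord_max.
Proof. by rewrite -val_eqE /= ltn_eqF. Qed.

Lemma max_notin_old (m : nat) (v : seq 'I_m) : ord_max \notin map (@old m) v.
Proof.
by apply/negP => /mapP[i _ /eqP]; rewrite eq_sym (negbTE (old_neq_max i)).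
Qed.

Lemma map_old_word (m : nat) (ps : seq ('I_m * 'I_m)) :
  map (@old m) (word ps) = word [seq (old p.1, old p.2) | p <- ps].
Proof. by rewrite /word map_flatten -!map_comp. Qed.

(** The default [ord_max] puts the apex at the last position, where it adds no inversion. *)
Lemma seq_perm (m : nat) (v : seq 'I_m) : uniq v -> size v = m ->
  exists2 s : {perm 'I_m.+1},
    forall i, s i = nth ord_max (map (@old m) v) i
    & odd_perm s = odd (inversions [seq val i | i <- v]).
Proof.
move=> uv sv; pose f (i : 'I_m.+1) := nth ord_max (map (@old m) v) i.
have fE i : f i = nth ord_max (rcons (map (@old m) v) ord_max) i.
  rewrite nth_rcons size_map sv /f; case: ltngtP => // h.
    by have := ltn_ord i; rewrite ltnS leqNgt h.
  by rewrite nth_default // size_map sv h.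
have f_inj : injective f.
  move=> i j; rewrite !fE => /eqP; rewrite nth_uniq ?size_rcons ?size_map ?sv //.
    by move/eqP/val_inj.
  by rewrite rcons_uniq max_notin_old map_inj_uniq //; apply: old_inj.
exists (perm f_inj) => [i|]; first by rewrite permE.
rewrite odd_perm_inversions.
have -> : [seq val (perm f_inj i) | i <- enum 'I_m.+1] =
          rcons [seq val i | i <- v] m.
  apply: (@eq_from_nth _ 0).
    by rewrite size_map size_enum_ord size_rcons size_map sv.
  rewrite size_map size_enum_ord => i im.
  rewrite (nth_map ord_max) ?size_enum_ord // permE fE nth_enum_ord //.
  by rewrite -(nth_map _ 0) ?size_rcons ?size_map ?sv // map_rcons -map_comp.
rewrite inversions_rcons // all_map; apply/allP=> i _ /=; exact: ltn_ord.
Qed.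

(** * Triples of the cone and words of perfect matchings *)

(** Taking the edge as a set avoids the choice of an order of its ends and makes the map
    injective. *)
Definition cone_edge (m : nat) (e : {set 'I_m}) : {set 'I_m.+1} :=
  ord_max |: [set old i | i in e].

Lemma cone_tripleE (m : nat) (i j : 'I_m) :
  cone_triple i j = cone_edge [set i; j].
Proof. by rewrite /cone_edge imsetU1 imset_set1 setUC. Qed.

Lemma mem_cone_edge (m : nat) (e : {set 'I_m}) (i : 'I_m) :
  (old i \in cone_edge e) = (i \in e).
Proof.
by rewrite !inE (negbTE (old_neq_max i)) (mem_imset _ _ (@old_inj m)).
Qed.

Lemma cone_edge_inj (m : nat) : injective (@cone_edge m).
Proof. by move=> e f ef; apply/setP=> i; rewrite -mem_cone_edge ef mem_cone_edge. Qed.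

Lemma old_or_max (m : nat) (x : 'I_m.+1) : x = ord_max \/ exists i, x = old i.
Proof.
have := ltn_ord x; rewrite ltnS leq_eqVlt => /predU1P[xm | xm].
  by left; apply: val_inj.
by right; exists (Ordinal xm); apply: val_inj.
Qed.

Lemma uniform2P (V : finType) (E : {set {set V}}) (e : {set V}) :
  uniform 2 E -> e \in E -> exists i j, i != j /\ e = [set i; j].
Proof. by move=> E2 /E2/eqP/cards2P[i [j [ij ->]]]; exists i, j. Qed.

Lemma cone_imset (m : nat) (E : {set {set 'I_m}}) :
  uniform 2 E -> cone E = [set cone_edge e | e in E].
Proof.
move=> E2; apply/setP=> t; apply/imsetP/imsetP => [[[i j]] | [e eE ->]].
  by rewrite inE /= => ijE ->; exists [set i; j]; rewrite ?cone_tripleE.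
have [i [j [_ eij]]] := uniform2P E2 eE.
by exists (i, j); rewrite ?inE -?eij //= cone_tripleE eij.
Qed.

Lemma orientation_asym (V : finType) (E : {set {set V}}) (D : rel V) (i j : V) :
  uniform 2 E -> orientation E D -> D i j -> ~~ D j i.
Proof.
move=> E2 [DE Dx] Dij; have ijE := DE _ _ Dij.
have ij : i != j by move/E2: ijE; rewrite cards2; case: eqP.
by have := Dx _ _ ij ijE; rewrite Dij.
Qed.

(** [D] selects one order of the ends of each edge. Lists allow any order of the factors, and
    singletons treat one triple at a time. *)
Lemma oriented_pairs (m : nat) (E : {set {set 'I_m}}) (D : rel 'I_m)
    (ts : seq {set 'I_m.+1}) :
  uniform 2 E -> orientation E D -> {subset ts <= cone E} ->
  exists2 ps : seq ('I_m * 'I_m), ts = [seq cone_triple p.1 p.2 | p <- ps]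
    & forall p, p \in ps -> D p.1 p.2.
Proof.
move=> E2 oD; elim: ts => [|t ts IH] sub; first by exists [::].
have [|ps -> Dps] := IH; first by move=> u uts; rewrite sub // inE uts orbT.
have /imsetP[[i j]] := sub t (mem_head _ _); rewrite inE /= => ijE ->.
have ij : i != j by move/E2: (ijE); rewrite cards2; case: eqP.
have := oD.2 i j ij ijE; case Dij: (D i j) => /= Dji.
  exists ((i, j) :: ps) => // p; rewrite inE => /predU1P[-> // | /Dps //].
exists ((j, i) :: ps); first by rewrite /= !cone_tripleE setUC.
by move=> p; rewrite inE => /predU1P[-> // | /Dps //].
Qed.

(** Counting gives the word m letters; since the blocks cover all m vertices, no letter repeats. *)
Lemma perfect_matching_word (m : nat) (E M : {set {set 'I_m}})
    (ps : seq ('I_m * 'I_m)) :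
  uniform 2 E -> perfect_matching E M ->
  M =i [seq [set p.1; p.2] | p <- ps] -> size ps = #|M| ->
  uniq (word ps) /\ size (word ps) = m.
Proof.
move=> E2 /andP[ME Mpart] Mps psM.
have M2 : {in M, forall e : {set 'I_m}, #|e| = 2}.
  by move=> e /(subsetP ME)/E2.
have wm : size (word ps) = m.
  have := card_uniform_partition M2 Mpart.
  by rewrite cardsT card_ord size_word psM mulnC.
split=> //; apply: (@leq_size_uniq _ (enum 'I_m)).
- exact: enum_uniq.
- move=> x _; have : x \in cover M by rewrite (cover_partition Mpart) inE.
  case/bigcupP=> e; rewrite Mps => /mapP[p pps ->].
  by rewrite !inE mem_word => xp; apply/hasP; exists p.
by rewrite size_enum_ord wm.
Qed.

(** * The sign of the cone over a perfect matching *)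

(** For any order [ts] of the triples, the oriented edges in that order, closed by the apex, list
    the cycle. The resulting sign depends only on [M] and [D]. *)
Lemma cone_presents (n : nat) (E M : {set {set 'I_(2 * n)}})
    (D : rel 'I_(2 * n)) (ts : seq {set 'I_(2 * n).+1}) :
  uniform 2 E -> orientation E D -> perfect_matching E M ->
  perm_eq ts (enum (cone M)) ->
  exists2 s, presents (cone M) (cone_orientation D) ts s
    & ((-1) ^+ odd_perm s)%R = (matching_sgn M * backward_sgn D M)%R.
Proof.
move=> E2 oD pM tsM; have /andP[ME _] := pM.
have M2 : uniform 2 M by move=> e /(subsetP ME)/E2.
have tsE : ts =i cone M by move=> t; rewrite (perm_mem tsM) mem_enum.
have [|ps tsps Dps] := @oriented_pairs _ E D ts E2 oD.
  move=> t; rewrite tsE !cone_imset // => /imsetP[e eM ->].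
  by rewrite imset_f // (subsetP ME).
have tsps' : ts = map (@cone_edge _) [seq [set p.1; p.2] | p <- ps].
  by rewrite tsps -map_comp; apply: eq_map => p /=; rewrite cone_tripleE.
have Mps : M =i [seq [set p.1; p.2] | p <- ps].
  move=> e; rewrite -(mem_map (@cone_edge_inj _)) -tsps' tsE cone_imset //.
  by rewrite mem_imset //; apply: cone_edge_inj.
have szps : size ps = #|M|.
  rewrite -(size_map (fun p => cone_triple p.1 p.2)) -tsps (perm_size tsM).
  by rewrite -cardE cone_imset // card_imset //; apply: cone_edge_inj.
have [uw szw] := perfect_matching_word E2 pM Mps szps.
have [s sE s_odd] := seq_perm uw szw.
have uW : uniq (ord_max :: map (@old _) (word ps)).
  by rewrite /= max_notin_old map_inj_uniq //; apply: old_inj.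
exists s.
  split=> // i; rewrite tsps big_map big_seq.
  rewrite (eq_bigr (fun p => cyc3 (old p.1) (old p.2) ord_max)); last first.
    by move=> p pps; apply: (cone_orientationE E2 oD); apply: Dps.
  rewrite -big_seq -(big_map (fun p => (old p.1, old p.2)) xpredT
                       (fun p => cyc3 p.1 p.2 ord_max)).
  rewrite map_old_word in uW sE.
  rewrite prod_cyc3_next // !sE next_nth_cons //.
    by rewrite -map_old_word size_map szw.
  by rewrite -map_old_word size_map szw -ltnS.
rewrite s_odd signr_odd (matching_sgn_word uw Mps).
rewrite (backward_sgn_word uw Mps Dps); last first.
  by move=> i j; apply: orientation_asym E2 oD.
by rewrite mulrC -exprD -[RHS]signr_odd -odd_inversions_word // signr_odd.
Qed.

(** An arbitrary [s] is compared with the one built from the same [ts]; they have equal sign because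
    the cycle length 2n + 1 is odd. *)
Lemma cone_tree_sgn (n : nat) (E M : {set {set 'I_(2 * n)}})
    (D : rel 'I_(2 * n)) :
  uniform 2 E -> orientation E D -> perfect_matching E M ->
  tree_sgn (cone M) (cone_orientation D)
    (matching_sgn M * backward_sgn D M)%R.
Proof.
move=> E2 oD pM; split=> [|ts s sP].
  have [s sP _] := cone_presents E2 oD pM (perm_refl _).
  by exists (enum (cone M)), s.
have [s' s'P <-] := cone_presents E2 oD pM sP.1.
by rewrite (presents_odd_perm _ sP s'P) // oddM.
Qed.

Lemma tree_sgn_unique (m : nat) (T : {set {set 'I_m}}) w (eps eps' : int) :
  tree_sgn T w eps -> tree_sgn T w eps' -> eps = eps'.
Proof. by move=> [[ts [s sP]] /(_ _ _ sP) <-] [_ /(_ _ _ sP)]. Qed.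

(** * Spanning trees of the cone *)

Lemma max_in_cone_edge (m : nat) (e : {set 'I_m}) : ord_max \in cone_edge e.
Proof. by rewrite setU11. Qed.

Lemma shared_vertex_has_cycle (m : nat) (T : {set {set 'I_m.+1}})
    (e f : {set 'I_m}) (i : 'I_m) :
  cone_edge e \in T -> cone_edge f \in T -> e != f -> i \in e -> i \in f ->
  has_cycle T.
Proof.
move=> eT fT ef ie jf.
have ord2_inj (A : eqType) (x y : A) : x != y ->
    injective (fun k : 'I_2 => if k == ord0 then x else y).
  move=> xy [[|[|//]] kP] [[|[|//]] lP] //= H; apply: val_inj => //=.
    by rewrite H eqxx in xy.
  by rewrite H eqxx in xy.
(* The cycle runs from [old i] through the triple of [e] to the apex and back through the triple of
   [f]. *)
exists 2, (fun k => if k == ord0 then old i else ord_max),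
  (fun k => if k == ord0 then cone_edge e else cone_edge f).
split=> //.
- by apply: ord2_inj; rewrite old_neq_max.
- by apply: ord2_inj; rewrite (inj_eq (@cone_edge_inj _)).
by case=> [[|[|//]] kP]; split; rewrite //= ?mem_cone_edge ?max_in_cone_edge.
Qed.

(** The edges cover because the triples cover the old vertices, and they are disjoint because a
    common vertex closes a cycle of length 2. *)
Lemma spanning_tree_cone_matching (m : nat) (E : {set {set 'I_m}})
    (T : {set {set 'I_m.+1}}) :
  uniform 2 E -> spanning_tree (cone E) T ->
  exists2 M, perfect_matching E M & T = cone M.
Proof.
move=> E2 [TE noC covT _]; pose M := [set e in E | cone_edge e \in T].
have ME : M \subset E by apply/subsetP=> e; rewrite inE => /andP[].
have M2 : uniform 2 M by move=> e /(subsetP ME)/E2.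
exists M; last first.
  rewrite cone_imset //; apply/setP=> t; apply/idP/imsetP => [tT | [e]].
    have := subsetP TE t tT; rewrite cone_imset // => /imsetP[e eE te].
    by exists e; rewrite // inE eE -te.
  by rewrite inE => /andP[_ eT] ->.
rewrite /perfect_matching ME /=; apply/and3P; split.
- apply/eqP/setP=> i; rewrite inE; apply/bigcupP.
  have : old i \in cover T by rewrite covT inE.
  case/bigcupP=> t tT it; have := subsetP TE t tT.
  rewrite cone_imset // => /imsetP[e eE te].
  by exists e; rewrite ?inE ?eE -?te // -mem_cone_edge -te.
- apply/trivIsetP=> e f; rewrite !inE => /andP[_ eT] /andP[_ fT] ef.
  rewrite -setI_eq0; apply/eqP/setP=> i; rewrite !inE; apply/negP=> /andP[ie jf].
  exact/noC/(shared_vertex_has_cycle eT fT ef ie jf).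
by apply/negP => /M2; rewrite cards0.
Qed.

Lemma matching_cone_meet (m : nat) (M : {set {set 'I_m}}) (t u : {set 'I_m.+1})
    (x : 'I_m.+1) :
  trivIset M -> t \in [set cone_edge e | e in M] ->
  u \in [set cone_edge e | e in M] -> t != u -> x \in t -> x \in u ->
  x = ord_max.
Proof.
move=> /trivIsetP tM /imsetP[e eM ->] /imsetP[f fM ->] ef.
have [-> // | [i ->]] := old_or_max x; rewrite !mem_cone_edge => ie jf.
have /tM dis : e != f by apply: contraNneq ef => ->.
by have := dis eM fM; rewrite -setI_eq0 => /eqP/setP/(_ i); rewrite !inE ie jf.
Qed.

(** At most two triples suffice, passing through the apex; the cases keep the vertices and triples
    of the path distinct. *)
Lemma joined_cone (m : nat) (T : {set {set 'I_m.+1}}) (x y : 'I_m.+1) :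
  (forall t, t \in T -> ord_max \in t) -> cover T = [set: 'I_m.+1] ->
  joined T x y.
Proof.
move=> Tmax covT.
have covered z : exists2 t, t \in T & z \in t.
  by apply/bigcupP; rewrite -/(cover T) covT inE.
have [<- | xy] := eqVneq x y.
  exists 0, (fun=> x), (fun=> set0); split=> //; last by case.
    by move=> i j _; rewrite !ord1.
  by case.
have joined1 t : t \in T -> x \in t -> y \in t -> joined T x y.
  move=> tT xt yt; exists 1, (fun i => if i == ord0 then x else y), (fun=> t).
  split=> //.
  - move=> [[|[|//]] kP] [[|[|//]] lP] //= H; apply: val_inj => //=.
      by rewrite H eqxx in xy.
    by rewrite H eqxx in xy.
  - by move=> i j _; rewrite !ord1.
  by move=> i; rewrite !ord1.
have [t tT xt] := covered x; have [u uT yu] := covered y.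
have [yt | yt] := boolP (y \in t); first exact: joined1 tT xt yt.
have [xu | xu] := boolP (x \in u); first exact: joined1 uT xu yu.
have tu : t != u by apply: contraNneq yt => ->.
have xm : x != ord_max by apply: contraNneq xu => ->; exact: Tmax.
have ym : y != ord_max by apply: contraNneq yt => ->; exact: Tmax.
(* The path x, t, apex, u, y; the defaults [y] and [u] supply its last vertex and last triple. *)
exists 2, (fun i : 'I_3 => nth y [:: x; ord_max] i),
  (fun i : 'I_2 => nth u [:: t] i).
split=> //.
- move=> [[|[|[|//]]] kP] [[|[|[|//]]] lP] //= H; apply: val_inj => //=;
    by move: H xy xm ym => ->; rewrite eqxx.
- move=> [[|[|//]] kP] [[|[|//]] lP] //= H; apply: val_inj => //=;
    by move: H tu => ->; rewrite eqxx.
by case=> [[|[|//]] kP] /=; split=> //; apply: Tmax.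
Qed.

(** Positivity of [m] provides an edge, hence a triple covering the apex. *)
Lemma matching_cone_spanning_tree (m : nat) (E M : {set {set 'I_m}}) :
  0 < m -> uniform 2 E -> perfect_matching E M -> spanning_tree (cone E) (cone M).
Proof.
move=> m_gt0 E2 /andP[ME Mpart].
have M2 : uniform 2 M by move=> e /(subsetP ME)/E2.
have covM i : exists2 e, e \in M & i \in e.
  by apply/bigcupP; rewrite -/(cover M) (cover_partition Mpart) inE.
have covT : cover (cone M) = [set: 'I_m.+1].
  apply/setP=> x; rewrite inE cone_imset //; apply/bigcupP.
  have [-> | [i ->]] := old_or_max x.
    have [e eM _] := covM (Ordinal m_gt0).
    by exists (cone_edge e); rewrite ?imset_f ?max_in_cone_edge.
  by have [e eM ie] := covM i; exists (cone_edge e); rewrite ?imset_f ?mem_cone_edge.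
split=> //.
- by rewrite !cone_imset // imsetS.
- case=> l [a [t [l_gt1 a_inj t_inj tP]]].
  have ordS_neq i : ordS i != i :> 'I_l.
    rewrite -val_eqE /=; have := ltn_ord i; rewrite leq_eqVlt => /predU1P[il | il].
      by rewrite [X in X %% l]il modnn; move: l_gt1; rewrite -{1}il; case: (val i).
    by rewrite modn_small // gtn_eqF.
  (* This vertex lies in two distinct consecutive triples, which meet only in the apex; so all
     vertices of the cycle would coincide. *)
  have a_max i : a (ordS i) = ord_max.
    have [tT _ at1] := tP i; have [uT at2 _] := tP (ordS i).
    move: tT uT; rewrite cone_imset // => tT uT.
    apply: matching_cone_meet tT uT _ at1 at2; first by case/and3P: Mpart.
    by rewrite (inj_eq t_inj) eq_sym ordS_neq.
  pose i0 := Ordinal (ltnW l_gt1).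
  have /a_inj/eqP : a (ordS (ordS i0)) = a (ordS i0) by rewrite !a_max.
  by rewrite (negbTE (ordS_neq _)).
move=> x y; apply: joined_cone => // t; rewrite cone_imset // => /imsetP[e _ ->].
exact: max_in_cone_edge.
Qed.

(** * The two cyclic orders of a triple *)

Lemma cyc3_rot (V : finType) (i j k : V) :
  uniq [:: i; j; k] -> cyc3 j k i = cyc3 i j k.
Proof.
move=> uijk; have ujki : uniq [:: j; k; i] by rewrite -(rot_uniq 1) in uijk.
have [ei ej ek eo] := cyc3E uijk; have [fj fk fi fo] := cyc3E ujki.
apply/permP=> x; have [xin | xout] := boolP (x \in [:: i; j; k]).
  move: xin; rewrite !inE => /or3P[]/eqP->.
  - by rewrite ei fi.
  - by rewrite ej fj.
  by rewrite ek fk.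
rewrite eo // fo //; apply: contra xout; rewrite !inE.
by case/or3P=> ->; rewrite ?orbT.
Qed.

Lemma cyc3_neq_rev (V : finType) (i j k : V) :
  uniq [:: i; j; k] -> cyc3 i j k != cyc3 j i k.
Proof.
move=> uijk; have ujik : uniq [:: j; i; k].
  by move: uijk; rewrite /= !inE !negb_or eq_sym => /and3P[/andP[-> ->] -> _].
have [ei _ _ _] := cyc3E uijk; have [_ fi _ _] := cyc3E ujik.
apply/eqP=> /permP/(_ i); rewrite ei fi => jk.
by move: uijk; rewrite jk /= !inE eqxx andbF.
Qed.

(** The six orders of a triple are the rotations of [i j k] and those of [j i k]. *)
Lemma cyc3_same_set (V : finType) (a b c i j k : V) :
  uniq [:: i; j; k] -> [set i; j; k] = [set a; b; c] ->
  cyc3 a b c = cyc3 i j k \/ cyc3 a b c = cyc3 j i k.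
Proof.
move=> uijk eqS.
have ujik : uniq [:: j; i; k].
  by move: uijk; rewrite /= !inE !negb_or eq_sym => /and3P[/andP[-> ->] -> _].
have uabc : uniq [:: a; b; c].
  have : #|[set a; b; c]| = 3.
    rewrite -eqS; have /card_uniqP := uijk; rewrite /= => <-.
    by apply: eq_card => x; rewrite !inE orbA.
  move=> card3; apply/card_uniqP; rewrite -[RHS]card3.
  by apply: eq_card => x; rewrite !inE orbA.
have rot2 (x y z : V) : uniq [:: x; y; z] -> cyc3 z x y = cyc3 x y z.
  move=> u; rewrite -(cyc3_rot u); apply: cyc3_rot.
  by rewrite -(rot_uniq 1) in u.
have [ain bin cin] :
    [/\ a \in [set i; j; k], b \in [set i; j; k] & c \in [set i; j; k]].
  by rewrite eqS !inE !eqxx ?orbT.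
move: uabc ain bin cin; rewrite /= !inE !negb_or -!orbA.
case/and3P=> /andP[ab ac] bc _.
case/or3P=> /eqP ea; case/or3P=> /eqP eb; case/or3P=> /eqP ec;
  move: ab ac bc; rewrite ea eb ec ?eqxx //= => _ _ _.
- by left.
- by right; apply: cyc3_rot ujik.
- by right.
- by left; apply: cyc3_rot uijk.
- by left; apply: rot2 uijk.
by right; apply: rot2 ujik.
Qed.

Lemma triple_orientation_cone (m : nat) (E : {set {set 'I_m}}) (D : rel 'I_m) :
  uniform 2 E -> orientation E D ->
  triple_orientation (cone E) (cone_orientation D).
Proof.
move=> E2 oD i j k uijk ijkE.
have [|[|[a b] []] //= []] := @oriented_pairs _ E D [:: [set i; j; k]] E2 oD.
  by move=> t; rewrite inE => /eqP->.
move=> tE /(_ _ (mem_head _ _)) /= Dab.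
by rewrite tE (cone_orientationE E2 oD Dab); apply: cyc3_same_set.
Qed.

(** * Equivalence of the two Pfaffian properties *)

Lemma pfaffian_cone (n : nat) (E : {set {set 'I_(2 * n)}}) (D : rel 'I_(2 * n)) :
  uniform 2 E -> orientation E D ->
  pfaffian E D <-> pfaffian3 (cone E) (cone_orientation D).
Proof.
move=> E2 oD; split=> [[_ [eps epsP]] | [_ [eps epsP]]].
  split; first exact: triple_orientation_cone.
  exists eps => T /(spanning_tree_cone_matching E2)[M pM ->].
  by rewrite -(epsP M pM); apply: cone_tree_sgn E2 oD pM.
(* For n = 0 the cone over the empty matching misses the apex and is no spanning tree; as the only
   matching, its own value serves as the constant. *)
split=> //; have [n0 | n_gt0] := posnP n.
  pose M0 : {set {set 'I_(2 * n)}} := set0.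
  exists (matching_sgn M0 * backward_sgn D M0)%R => M /andP[ME _].
  suff -> : M = M0 by [].
  apply/setP=> e; rewrite inE; apply/negP=> /(subsetP ME) eE.
  have [i _] := uniform2P E2 eE.
  by have := leq_ltn_trans (leq0n i) (ltn_ord i); rewrite n0.
exists eps => M pM; apply: tree_sgn_unique (cone_tree_sgn E2 oD pM) _.
by apply: epsP; apply: matching_cone_spanning_tree; rewrite ?muln_gt0.
Qed.

(** * From triple orientations back to graph orientations *)

Definition base_orientation (m : nat) (E : {set {set 'I_m}})
    (w : {set 'I_m.+1} -> {perm 'I_m.+1}) : rel 'I_m :=
  fun i j => ([set i; j] \in E) &&
    (w (cone_triple i j) == cyc3 (old i) (old j) ord_max).

(** Exactly one direction holds because the two 3-cycles on a triple differ. *)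
Lemma base_orientationP (m : nat) (E : {set {set 'I_m}})
    (w : {set 'I_m.+1} -> {perm 'I_m.+1}) :
  uniform 2 E -> triple_orientation (cone E) w ->
  orientation E (base_orientation E w).
Proof.
move=> E2 wP; split=> [i j /andP[] // | i j ij ijE].
have uij : uniq [:: old i; old j; ord_max].
  by rewrite /= !inE !negb_or !old_neq_max (inj_eq (@old_inj m)) ij.
have tE : cone_triple i j \in cone E.
  by rewrite cone_imset // cone_tripleE imset_f.
have ne := cyc3_neq_rev uij.
rewrite /base_orientation (setUC [set j]) ijE /= !cone_tripleE (setUC [set j]).
rewrite -cone_tripleE.
by have [-> | ->] := wP _ _ _ uij tE; rewrite eqxx ?(negbTE ne) // eq_sym (negbTE ne).
Qed.

Lemma cone_base_orientation (m : nat) (E : {set {set 'I_m}})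
    (w : {set 'I_m.+1} -> {perm 'I_m.+1}) :
  uniform 2 E -> triple_orientation (cone E) w ->
  {in cone E, w =1 cone_orientation (base_orientation E w)}.
Proof.
move=> E2 wP t tE; have oD := base_orientationP E2 wP.
have [|[|[a b] []] //= []] := @oriented_pairs _ E _ [:: t] E2 oD.
  by move=> u; rewrite inE => /eqP->.
move=> -> /(_ _ (mem_head _ _)) /= Dab.
by rewrite (cone_orientationE E2 oD Dab); case/andP: Dab => _ /eqP.
Qed.

(** Only triples of [T] enter the product, so disagreement outside the cone is harmless. *)
Lemma eq_tree_sgn (m : nat) (T : {set {set 'I_m}})
    (w w' : {set 'I_m} -> {perm 'I_m}) (eps : int) :
  {in T, w =1 w'} -> tree_sgn T w eps -> tree_sgn T w' eps.
Proof.
move=> ww'; have presE ts s : presents T w ts s <-> presents T w' ts s.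
  suff prodE : perm_eq ts (enum T) ->
      (\prod_(t <- ts) w t = \prod_(t <- ts) w' t)%g.
    by split=> -[tsT sP]; split=> // i; rewrite -sP prodE.
  move=> tsT; apply: eq_big_seq => t; rewrite (perm_mem tsT) mem_enum.
  exact: ww'.
by case=> [[ts [s /presE sP]] epsP]; split=> [|us u /presE/epsP //]; exists ts, s.
Qed.

Theorem theorem4p7 (n : nat) (E : {set {set 'I_(2 * n)}}) (hE : uniform 2 E) :
  ((exists w, pfaffian3 (cone E) w) <-> (exists D, pfaffian E D)) /\
  (forall D : rel 'I_(2 * n), orientation E D ->
     (pfaffian E D <-> pfaffian3 (cone E) (cone_orientation D))).
Proof.
split=> [|D]; last exact: pfaffian_cone.
split=> [[w [wP [eps epsP]]] | [D pD]]; last first.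
  by exists (cone_orientation D); apply/(pfaffian_cone hE) => //; case: pD.
have oD := base_orientationP hE wP.
(* On the cone, [w] is the cone orientation of this [D], so the equivalence for a fixed orientation
   applies. *)
exists (base_orientation E w); apply/(pfaffian_cone hE oD); split.
  exact: triple_orientation_cone.
exists eps => T stT; apply: eq_tree_sgn (epsP T stT) => t tT.
by apply: cone_base_orientation => //; case: stT => /subsetP-> .
Qed.
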